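(* Let $\mathbb{K} \in \{\mathbb{R}, \mathbb{C}\}$ and $k\geq 2$. For any $\varepsilon > 0$ and any tensor $\tau \in \mathbb{K}^{[n]^k}$ there exist an integer $0\le K \le 1/\varepsilon^2$ and a decomposition $$\tau = \sum_{j=1}^{K}\lambda_j (\boldsymbol{u}_{j,1}\otimes\dots\otimes \boldsymbol{u}_{j,k}) + Q \qquad \text{with}\qquad \lambda_{\max}(Q) \le \varepsilon\|\tau\|_F,$$ with unit vectors $\boldsymbol{u}_{j,1},\ldots,\boldsymbol{u}_{j,k}\in\mathbb{K}^n$ ($j\in[K]$) and $\lambda_1, \ldots, \lambda_K\in\mathbb{R}$ satisfying $\lambda_j > \varepsilon\|\tau\|_F$ for all $j \in [K]$. In this decomposition each $(\lambda_j; \boldsymbol{u}_{j,1}, \ldots, \boldsymbol{u}_{j,k})$ may be chosen to be a top eigenpair of the residual tensor $\tau -\sum_{i=1}^{j-1}\lambda_i(\boldsymbol{u}_{i,1}\otimes\cdots\otimes\boldsymbol{u}_{i,k})$. Moreover, for a symmetric $\tau$ we may choose the factors all equal, $\boldsymbol{u}_{j,1}=\dots=\boldsymbol{u}_{j,k}=:\boldsymbol{u}_j$ for $j\in[K]$, so that the rank-one tensors are $\boldsymbol{u}_j^{\otimes k}$, at the cost that for $\mathbb{K}=\mathbb{R}$ and $k$ even the condition on the $\lambda_j$'s is relaxed to $|\lambda_j| > \varepsilon\|\tau\|_F$, $j \in [K]$.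
   Context: Let $[n]=\{1,\dots,n\}$. A tensor $\tau=(\tau_{i_1\cdots i_k})\in\mathbb{K}^{[n]^k}$ acts as a $k$-linear form $\tau(\boldsymbol{u}_1,\ldots,\boldsymbol{u}_k)=\sum_{i_1,\ldots,i_k\in[n]}\tau_{i_1\cdots i_k}\boldsymbol{u}_1(i_1)\cdots\boldsymbol{u}_k(i_k)$ on $\mathbb{K}^n$ (no conjugation). It is symmetric if $\tau_{i_{\pi(1)}\cdots i_{\pi(k)}}=\tau_{i_1\cdots i_k}$ for every permutation $\pi$ of $[k]$. $\|\cdot\|$ is the Euclidean norm on $\mathbb{K}^n$, and unit vectors are vectors of norm $1$. The top eigenvalue of $\tau$ is $\lambda_{\max}(\tau)=\sup|\tau(\boldsymbol{u}_1,\ldots,\boldsymbol{u}_k)|$ over all unit vectors $\boldsymbol{u}_1,\ldots,\boldsymbol{u}_k\in\mathbb{K}^n$. The Frobenius norm is $\|\tau\|_F=\bigl(\sum_{i_1,\ldots,i_k}|\tau_{i_1\cdots i_k}|^2\bigr)^{1/2}$. The rank-one tensor $\boldsymbol{u}_1\otimes\cdots\otimes\boldsymbol{u}_k$ has entries $\boldsymbol{u}_1(i_1)\cdots\boldsymbol{u}_k(i_k)$, and $\boldsymbol{u}^{\otimes k}$ denotes the case of all factors equal to $\boldsymbol{u}$. A tuple $(\lambda;\boldsymbol{u}_1,\ldots,\boldsymbol{u}_k)$ with unit vectors $\boldsymbol{u}_i\in\mathbb{K}^n$, $\lambda=\tau(\overline{\boldsymbol{u}_1},\ldots,\overline{\boldsymbol{u}_k})$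 (entrywise complex conjugates) and $|\lambda|=\lambda_{\max}(\tau)$ is called a top eigenpair of $\tau$. *)

(* Defs.v *)
From HB Require Import structures.
From mathcomp Require Import all_boot all_order all_fingroup all_algebra.
From mathcomp Require Import classical_sets reals.
From mathcomp Require Import complex.

Set Implicit Arguments.
Unset Strict Implicit.
Unset Printing Implicit Defensive.

Import Order.TTheory GRing.Theory Num.Theory.

Local Open Scope ring_scope.
Local Open Scope classical_set_scope.

Variant scalar_kind := RealScalars | ComplexScalars.

Definition scalars (R : realType) (F : scalar_kind) : numFieldType :=
  match F with
  | RealScalars => R
  | ComplexScalars => complex R
  end.

Definition of_real (R : realType) (F : scalar_kind) : R -> scalars R F :=
  match F with
  | RealScalars => id
  | ComplexScalars => fun x => Complex x 0
  end.

(* The modulus as an element of [R]: the library norm of [complex R] takes its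
   values in [complex R], where suprema are not available. *)
Definition modulus (R : realType) (F : scalar_kind) : scalars R F -> R :=
  match F with
  | RealScalars => fun x => `|x|
  | ComplexScalars => fun z => ComplexField.Normc.normc z
  end.

Definition conj_scalar (R : realType) (F : scalar_kind) :
    scalars R F -> scalars R F :=
  match F with
  | RealScalars => id
  | ComplexScalars => fun z => conjc z
  end.

Section Tensors.
Variables (R : realType) (F : scalar_kind) (n k : nat).
Local Notation K := (scalars R F).
Local Notation index := {ffun 'I_k -> 'I_n}.

(* [K^o] is [K] seen as a module over itself, which makes tensors an
   [lmodType K]. *)
Definition tensor := {ffun index -> K^o}.

Definition enorm (v : 'rV[K]_n) : R :=
  Num.sqrt (\sum_(i < n) modulus (v 0 i) ^+ 2).

Definition unit_vectors (u : 'I_k -> 'rV[K]_n) : Prop :=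
  forall l, enorm (u l) = 1.

Definition tensor_form (tau : tensor) (u : 'I_k -> 'rV[K]_n) : K :=
  \sum_(i : index) (tau i : K) * \prod_(l < k) u l 0 (i l).

Definition symmetric_tensor (tau : tensor) : Prop :=
  forall (s : 'S_k) (i : index), tau [ffun l => i (s l)] = tau i.

(* For [n = 0] and [0 < k] there are no unit vectors, and [sup set0 = 0]. *)
Definition lambda_max (tau : tensor) : R :=
  sup [set modulus (tensor_form tau u) | u in unit_vectors].

Definition frobenius_norm (tau : tensor) : R :=
  Num.sqrt (\sum_(i : index) modulus (tau i : K) ^+ 2).

Definition rank_one (u : 'I_k -> 'rV[K]_n) : tensor :=
  [ffun i : index => \prod_(l < k) u l 0 (i l)].

Definition top_eigenpair (tau : tensor) (lam : K) (u : 'I_k -> 'rV[K]_n)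
    : Prop :=
  [/\ unit_vectors u,
      lam = tensor_form tau (fun l => map_mx (@conj_scalar R F) (u l)) &
      modulus lam = lambda_max tau].

End Tensors.

Arguments tensor : clear implicits.

(* Main.v *)
(* Greedy peeling: as long as the residual has top eigenvalue above the threshold
   [theta = eps * |tau|_F], subtract the rank-one term of a top eigenpair.  Since
   [lambda] is the inner product of the residual with that unit rank-one tensor,
   the squared Frobenius norm drops by [lambda ^ 2 > theta ^ 2], so there are at
   most [1 / eps ^ 2] steps.  Top eigenpairs exist by compactness of the set of
   unit tuples, a phase being absorbed in one of the factors.

   In the symmetric case one needs Banach's theorem that the maximum is also
   attained on the diagonal.  If [x] and [y] sit in two slots of a maximizing
   tuple and [c] is the value of the form there, the equality case of
   Cauchy-Schwarz gives [B x z = c <z, y>] and [B y z = c <z, x>], where [B] is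
   the form with the other slots frozen; hence [B w w = c |w|^2] for [w = x + y],
   and [B w w = - c |w|^2] for [w = x - y].  So both bisectors again yield
   maximizing tuples, and among all maximizing tuples one which also maximizes
   the sum of the [(Re <u_p, u_q>)^2] must have all its vectors equal up to
   sign. *)

Require Import Defs.
From HB Require Import structures.
From mathcomp Require Import all_boot all_order all_fingroup all_algebra.
From mathcomp Require Import classical_sets reals.
From mathcomp Require Import boolp topology normedtype derive complex ring lra.

Set Implicit Arguments.
Unset Strict Implicit.
Unset Printing Implicit Defensive.

Import Order.TTheory GRing.Theory Num.Theory.
Import numFieldNormedType.Exports.

Local Open Scope ring_scope.

(** * Scalars *)

Section Scalars.
Variables (R : realType) (F : scalar_kind).
Local Notation K := (scalars R F).
Implicit Types (x y z : K) (a b : R).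

Lemma of_real_is_zmod_morphism : zmod_morphism (@of_real R F).
Proof. by case: F => // a b; rewrite /= -[RHS]/(Complex _ _) subrr. Qed.

Lemma of_real_is_monoid_morphism : monoid_morphism (@of_real R F).
Proof.
case: F; first by split.
by split=> // a b; apply/eqP; rewrite eq_complex /= !(mul0r, mulr0, subr0, addr0) !eqxx.
Qed.

HB.instance Definition _ :=
  GRing.isZmodMorphism.Build R K (@of_real R F) of_real_is_zmod_morphism.
HB.instance Definition _ :=
  GRing.isMonoidMorphism.Build R K (@of_real R F) of_real_is_monoid_morphism.

Lemma conj_scalar_is_zmod_morphism : zmod_morphism (@conj_scalar R F).
Proof. by case: F => // a b; rewrite /= raddfB. Qed.

Lemma conj_scalar_is_monoid_morphism : monoid_morphism (@conj_scalar R F).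
Proof.
case: F; first by split.
by split=> [|a b]; [exact: (rmorph1 (@conjc R)) | exact: (rmorphM (@conjc R))].
Qed.

HB.instance Definition _ :=
  GRing.isZmodMorphism.Build K K (@conj_scalar R F) conj_scalar_is_zmod_morphism.
HB.instance Definition _ :=
  GRing.isMonoidMorphism.Build K K (@conj_scalar R F)
    conj_scalar_is_monoid_morphism.

Lemma conj_scalarK : involutive (@conj_scalar R F).
Proof. by case: F => // z; rewrite /= conjcK. Qed.

Lemma conj_of_real a : conj_scalar (of_real F a) = of_real F a.
Proof. by case: F => //=; rewrite oppr0. Qed.

Definition re_scalar : K -> R :=
  match F as F0 return scalars R F0 -> R with
  | RealScalars => id
  | ComplexScalars => fun c => complex.Re c
  end.

Definition im_scalar : K -> R :=
  match F as F0 return scalars R F0 -> R with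
  | RealScalars => fun=> 0
  | ComplexScalars => fun c => complex.Im c
  end.

(** Over the reals the value 0 lets [scalarE] hold uniformly and makes the imaginary coordinates in
    [tuple_of_coords] ineffective. *)
Definition scalar_i : K :=
  match F as F0 return scalars R F0 with
  | RealScalars => 0
  | ComplexScalars => Complex 0 1
  end.

Lemma re_scalar_is_zmod_morphism : zmod_morphism re_scalar.
Proof. by rewrite /re_scalar; case: F => // -[a b] [c d]. Qed.

HB.instance Definition _ :=
  GRing.isZmodMorphism.Build K R re_scalar re_scalar_is_zmod_morphism.

Lemma im_scalar_is_zmod_morphism : zmod_morphism im_scalar.
Proof.
by rewrite /im_scalar; case: F => [a b|[a b] [c d]] //; rewrite subrr.
Qed.

HB.instance Definition _ :=
  GRing.isZmodMorphism.Build K R im_scalar im_scalar_is_zmod_morphism.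

Lemma scalarE z :
  z = of_real F (re_scalar z) + scalar_i * of_real F (im_scalar z).
Proof.
rewrite /re_scalar /im_scalar /scalar_i; case: F z => [z|[a b]] /=.
  by rewrite mul0r addr0.
by apply/eqP; rewrite eq_complex /= !(mul0r, mul1r, mulr0, subr0, addr0, add0r) !eqxx.
Qed.

Lemma re_scalarM x y :
  re_scalar (x * y) =
  re_scalar x * re_scalar y - im_scalar x * im_scalar y.
Proof.
rewrite /re_scalar /im_scalar; case: F x y => [x y|[a b] [c d]] //=.
by rewrite mulr0 subr0.
Qed.

Lemma im_scalarM x y :
  im_scalar (x * y) =
  re_scalar x * im_scalar y + im_scalar x * re_scalar y.
Proof.
rewrite /re_scalar /im_scalar; case: F x y => [x y|[a b] [c d]] //=.
by rewrite mulr0 mul0r addr0.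
Qed.

Lemma re_of_real a : re_scalar (of_real F a) = a.
Proof. by rewrite /re_scalar; case: F. Qed.

Lemma im_of_real a : im_scalar (of_real F a) = 0.
Proof. by rewrite /im_scalar; case: F. Qed.

Lemma re_of_realM a z : re_scalar (of_real F a * z) = a * re_scalar z.
Proof. by rewrite re_scalarM re_of_real im_of_real mul0r subr0. Qed.

Lemma re_conj z : re_scalar (conj_scalar z) = re_scalar z.
Proof. by rewrite /re_scalar; case: F z => // -[]. Qed.

Lemma im_conj z : im_scalar (conj_scalar z) = - im_scalar z.
Proof. by rewrite /im_scalar; case: F z => [z|[]] //=; rewrite oppr0. Qed.

Lemma sqr_modulus z :
  modulus z ^+ 2 = re_scalar z ^+ 2 + im_scalar z ^+ 2.
Proof.
rewrite /re_scalar /im_scalar; case: F z => [z|[a b]] /=.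
  by rewrite real_normK ?num_real// expr0n addr0.
by rewrite sqr_sqrtr// addr_ge0 ?sqr_ge0.
Qed.

Lemma sqr_modulusE z : modulus z ^+ 2 = re_scalar (z * conj_scalar z).
Proof. by rewrite sqr_modulus re_scalarM re_conj im_conj mulrN opprK. Qed.

Lemma scalar_eqP x y :
  re_scalar x = re_scalar y -> im_scalar x = im_scalar y -> x = y.
Proof. by move=> ere eim; rewrite (scalarE x) ere eim -scalarE. Qed.

Lemma mul_conj z : z * conj_scalar z = of_real F (modulus z ^+ 2).
Proof.
apply: scalar_eqP; rewrite ?re_of_real ?im_of_real -?sqr_modulusE//.
by rewrite im_scalarM re_conj im_conj mulrN mulrC addNr.
Qed.

Lemma modulus_ge0 z : 0 <= modulus z.
Proof. by case: F z => [z|[a b]] /=; rewrite ?normr_ge0 ?sqrtr_ge0. Qed.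

Lemma modulusM x y : modulus (x * y) = modulus x * modulus y.
Proof.
by case: F x y => [x y|x y] /=; [rewrite normrM|exact: ComplexField.Normc.normcM].
Qed.

Lemma sqr_modulusB x y :
  modulus (x - y) ^+ 2 =
  modulus x ^+ 2 + modulus y ^+ 2 - 2 * re_scalar (x * conj_scalar y).
Proof. by rewrite !sqr_modulus re_scalarM re_conj im_conj !raddfB /=; ring. Qed.

Lemma modulus_of_real a : modulus (of_real F a) = `|a|.
Proof. by case: F => //=; rewrite expr0n addr0 sqrtr_sqr. Qed.

Lemma modulus_conj z : modulus (conj_scalar z) = modulus z.
Proof. by case: F z => // -[a b] /=; rewrite sqrrN. Qed.

Lemma modulus0 : modulus (0 : K) = 0.
Proof. by rewrite -(rmorph0 (of_real F)) modulus_of_real normr0. Qed.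

Lemma modulus1 : modulus (1 : K) = 1.
Proof. by rewrite -(rmorph1 (of_real F)) modulus_of_real normr1. Qed.

Lemma modulusN z : modulus (- z) = modulus z.
Proof.
by rewrite -mulN1r modulusM -(rmorphN1 (of_real F)) modulus_of_real normrN1 mul1r.
Qed.

Lemma modulus_prod (I : finType) (f : I -> K) :
  modulus (\prod_i f i) = \prod_i modulus (f i).
Proof. by rewrite (big_morph (@modulus R F) modulusM modulus1). Qed.

Lemma modulusX m z : modulus (z ^+ m) = modulus z ^+ m.
Proof. by elim: m => [|m IH]; rewrite ?expr0 ?modulus1// !exprS modulusM IH. Qed.

Lemma modulus_eq0 z : (modulus z == 0) = (z == 0).
Proof.
apply/eqP/eqP => [z0|->]; last exact: modulus0.
case: F z z0 => [z /normr0_eq0|z] //=; exact: ComplexField.Normc.eq0_normc.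
Qed.

Lemma re_le_abs_modulus z : `|re_scalar z| <= modulus z.
Proof.
rewrite -(@ler_sqr R) ?nnegrE ?modulus_ge0//.
by rewrite sqr_modulus real_normK ?num_real// lerDl sqr_ge0.
Qed.

Lemma im_le_abs_modulus z : `|im_scalar z| <= modulus z.
Proof.
rewrite -(@ler_sqr R) ?nnegrE ?modulus_ge0//.
by rewrite sqr_modulus real_normK ?num_real// lerDr sqr_ge0.
Qed.

End Scalars.

(** Over the complex numbers [w] is a [k]-th root of [|z| / z]; over the reals it is the sign of
    [z], whose odd powers are itself. Used with exponent 1 to put a phase in a single slot, and with
    exponent [k] when all slots share one vector. *)
Lemma exists_root_phase (R : realType) (F : scalar_kind) (k : nat)
    (z : scalars R F) :
  (0 < k)%N -> (F = RealScalars -> odd k) -> 0 < modulus z ->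
  exists w : scalars R F, modulus w = 1 /\ w ^+ k * z = of_real F (modulus z).
Proof.
move=> k0 + z0; case: F z z0 => [z z0 /(_ erefl) ok|z z0 _].
  exists (Num.sg z); split; first by rewrite /= normr_sg -normr_gt0 z0.
  have sgE : Num.sg (z : R) ^+ k * (z : R) = `|(z : R)|.
    by rewrite sgr_odd ?ok ?expr1 -?normrEsg// -normr_gt0.
  exact: sgE.
have zn0 : z != 0 by rewrite -modulus_eq0 gt_eqF.
have [w wE] : exists w : complex R, w ^+ k = of_real ComplexScalars (modulus z) / z.
  exists (k.-root (of_real ComplexScalars (modulus z) / z : complex R)).
  exact: rootCK.
exists w; split; last by rewrite wE divfK.
have : modulus (w : scalars R ComplexScalars) ^+ k = 1.
  apply: (mulIf (lt0r_neq0 z0)); rewrite mul1r -modulusX -modulusM.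
  by rewrite [w ^+ k]wE divfK// modulus_of_real ger0_norm// modulus_ge0.
by move/eqP; rewrite pexpr_eq1// ?modulus_ge0// => /eqP.
Qed.

(** * Compactness *)

Lemma continuous_sum (R : realType) (T : topologicalType) (I : Type)
    (r : seq I) (P : pred I) (f : I -> T -> R) :
  (forall i, continuous (f i)) -> continuous (fun t => \sum_(i <- r | P i) f i t).
Proof.
move=> cf; elim: r => [|i r IH].
  by under eq_fun do rewrite big_nil; exact: cst_continuous.
under eq_fun do rewrite big_cons; case: (P i) => // t.
by apply: continuousD; [exact: cf|exact: IH].
Qed.

(** * Continuity of scalar-valued functions *)

Section ScalarContinuity.
Variables (R : realType) (F : scalar_kind) (T : topologicalType).
Local Notation K := (scalars R F).

(* The library topologises [complex R] through a norm with values in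
   [complex R]; going through real and imaginary parts stays over [R]. *)
Definition scalar_continuous (f : T -> K) : Prop :=
  continuous (fun t => re_scalar (f t)) /\ continuous (fun t => im_scalar (f t)).

Lemma scalar_continuous_cst (z : K) : scalar_continuous (fun=> z).
Proof. by split; exact: cst_continuous. Qed.

Lemma scalar_continuousD (f g : T -> K) :
  scalar_continuous f -> scalar_continuous g ->
  scalar_continuous (fun t => f t + g t).
Proof.
move=> [f1 f2] [g1 g2]; split=> t.
  rewrite (_ : (fun t => _) = (fun t => re_scalar (f t)) \+
    (fun t => re_scalar (g t))); last by apply/funext => s; rewrite raddfD.
  by apply: continuousD; [exact: f1|exact: g1].
rewrite (_ : (fun t => _) = (fun t => im_scalar (f t)) \+
  (fun t => im_scalar (g t))); last by apply/funext => s; rewrite raddfD.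
by apply: continuousD; [exact: f2|exact: g2].
Qed.

Lemma scalar_continuousM (f g : T -> K) :
  scalar_continuous f -> scalar_continuous g ->
  scalar_continuous (fun t => f t * g t).
Proof.
move=> [f1 f2] [g1 g2]; split=> t.
  under eq_fun do rewrite re_scalarM.
  by apply: cvgB; apply: cvgM;
    [exact: f1|exact: g1|exact: f2|exact: g2].
under eq_fun do rewrite im_scalarM.
by apply: cvgD; apply: cvgM;
  [exact: f1|exact: g2|exact: f2|exact: g1].
Qed.

Lemma scalar_continuous_of_real (f : T -> R) :
  continuous f -> scalar_continuous (fun t => of_real F (f t)).
Proof.
move=> cf; split; first by under eq_fun do rewrite re_of_real.
by under eq_fun do rewrite im_of_real; exact: cst_continuous.
Qed.

Lemma scalar_continuous_conj (f : T -> K) :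
  scalar_continuous f -> scalar_continuous (fun t => conj_scalar (f t)).
Proof.
move=> [f1 f2]; split; first by under eq_fun do rewrite re_conj.
by under eq_fun do rewrite im_conj; move=> t; apply: cvgN; exact: f2.
Qed.

Lemma scalar_continuous_sum (I : Type) (r : seq I) (P : pred I)
    (f : I -> T -> K) :
  (forall i, scalar_continuous (f i)) ->
  scalar_continuous (fun t => \sum_(i <- r | P i) f i t).
Proof.
move=> cf; elim: r => [|i r IH].
  under [fun t => _]eq_fun do rewrite big_nil; exact: scalar_continuous_cst.
under [fun t => _]eq_fun do rewrite big_cons; case: (P i) => //.
exact: scalar_continuousD.
Qed.

Lemma scalar_continuous_prod (I : Type) (r : seq I) (P : pred I)
    (f : I -> T -> K) :
  (forall i, scalar_continuous (f i)) ->
  scalar_continuous (fun t => \prod_(i <- r | P i) f i t).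
Proof.
move=> cf; elim: r => [|i r IH].
  under [fun t => _]eq_fun do rewrite big_nil; exact: scalar_continuous_cst.
under [fun t => _]eq_fun do rewrite big_cons; case: (P i) => //.
exact: scalar_continuousM.
Qed.

Lemma continuous_sqr_modulus (f : T -> K) :
  scalar_continuous f -> continuous (fun t => modulus (f t) ^+ 2).
Proof.
move=> [f1 f2] t; under eq_fun do rewrite sqr_modulus !expr2.
by apply: cvgD; apply: cvgM;
  [exact: f1|exact: f1|exact: f2|exact: f2].
Qed.

End ScalarContinuity.

(** * Maximization over tuples of unit vectors *)

Section Coordinates.
Variables (R : realType) (F : scalar_kind) (n k : nat).
Local Notation K := (scalars R F).
Local Notation coords := 'rV[R]_#|{: 'I_k * 'I_n * bool}|.

Definition tuple_of_coords (p : coords) (l : 'I_k) : 'rV[K]_n :=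
  \row_j (of_real F (p 0 (enum_rank (l, j, false))) +
          scalar_i R F * of_real F (p 0 (enum_rank (l, j, true)))).

Definition coords_of_tuple (u : 'I_k -> 'rV[K]_n) : coords :=
  \row_i let: (l, j, b) := enum_val i in
         (if b then im_scalar (u l 0 j) else re_scalar (u l 0 j)).

Lemma coords_of_tupleK u : tuple_of_coords (coords_of_tuple u) = u.
Proof.
apply/funext => l; apply/rowP => j.
by rewrite !mxE !enum_rankK -scalarE.
Qed.

Lemma tuple_of_coords_continuous l j :
  scalar_continuous (fun p : coords => tuple_of_coords p l 0 j).
Proof.
under [fun p => _]eq_fun do rewrite mxE.
apply: scalar_continuousD; last apply: scalar_continuousM.
- by apply: scalar_continuous_of_real; exact: coord_continuous.
- exact: scalar_continuous_cst.
- by apply: scalar_continuous_of_real; exact: coord_continuous.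
Qed.

Lemma unit_entry_le1 (v : 'rV[K]_n) j : enorm v = 1 -> modulus (v 0 j) <= 1.
Proof.
move=> v1; rewrite -(@ler_sqr R) ?nnegrE ?modulus_ge0// expr1n.
rewrite -[leRHS](expr1n _ 2) -v1 /enorm sqr_sqrtr; last first.
  by apply: sumr_ge0 => i _; exact: sqr_ge0.
by rewrite (bigD1 j)//= lerDl sumr_ge0// => i _; exact: sqr_ge0.
Qed.

Lemma coords_of_tuple_le1 u i : unit_vectors u -> `|coords_of_tuple u 0 i| <= 1.
Proof.
move=> uu; rewrite mxE; case: (enum_val i) => [[l j] b].
apply: le_trans (unit_entry_le1 j (uu l)).
by case: b; [exact: im_le_abs_modulus|exact: re_le_abs_modulus].
Qed.

(** Closedness and continuity are asked of the pullbacks to real coordinates, where the extreme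
    value theorem applies. The set [A] is arbitrary so as to serve both for all unit tuples and for
    the maximizing tuples alone. *)
Lemma argmax_unit_tuple (A : set ('I_k -> 'rV[K]_n))
    (f : ('I_k -> 'rV[K]_n) -> R) :
  A !=set0%classic -> (forall u, A u -> unit_vectors u) ->
  closed (fun p => A (tuple_of_coords p)) ->
  continuous (fun p => f (tuple_of_coords p)) ->
  exists2 v, A v & forall u, A u -> f u <= f v.
Proof.
move=> [u0 Au0] Au Acl fc.
(* The box gives compactness: over the reals the imaginary coordinates do not affect the tuple, so
   the preimage of [A] can be unbounded. Every tuple of [A] still has its coordinates in [B]. *)
pose B : set coords := [set p | A (tuple_of_coords p) /\
   forall i, (`[-1, 1] : set R) (p ord0 i)]%classic.
have Bco u : A u -> B (coords_of_tuple u).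
  move=> Au'; split; first by rewrite coords_of_tupleK.
  by move=> i /=; rewrite in_itv/= -ler_norml; exact/coords_of_tuple_le1/Au.
have Bcpt : compact B.
  have -> : B = ((fun p => A (tuple_of_coords p)) `&`
      [set p : coords | forall i, (`[-1, 1]%classic : set R) (p ord0 i)])%classic.
    by [].
  rewrite setIC; apply: compact_closedI; last exact: Acl.
  apply: (@rV_compact _ _ (fun=> `[-1, 1]%classic : set R)) => i; exact: segment_compact.
have [||p pB pmax] := @EVT_max_rV R _ (fun p => f (tuple_of_coords p)) B _ Bcpt.
- by exists (coords_of_tuple u0); exact: Bco.
- by apply: continuous_subspaceT; exact: fc.
rewrite inE in pB; exists (tuple_of_coords p); first exact: pB.1.
by move=> u /Bco Bu; rewrite -{1}(coords_of_tupleK u); apply: pmax; rewrite inE.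
Qed.

End Coordinates.

(** * Multilinear forms *)

Section InnerProduct.
Variables (R : realType) (F : scalar_kind) (n : nat).
Local Notation K := (scalars R F).
Implicit Types (x y z : 'rV[K]_n).

(** No conjugation here, in line with [tensor_form]; [hdot] below is the Hermitian product,
    conjugate-linear in its second argument. *)
Definition pairing x y : K := \sum_j x 0 j * y 0 j.

Definition hdot x y : K := \sum_j x 0 j * conj_scalar (y 0 j).

(** The Euclidean inner product of the underlying real vector space, symmetric for both kinds of
    scalars. *)
Definition rdot x y : R := re_scalar (hdot x y).

Lemma pairingZl a x y : pairing (a *: x) y = a * pairing x y.
Proof. by rewrite mulr_sumr; apply: eq_bigr => j _; rewrite mxE mulrA. Qed.

Lemma pairingDl x y a : pairing (x + y) a = pairing x a + pairing y a.
Proof. by rewrite -big_split; apply: eq_bigr => j _; rewrite mxE mulrDl. Qed.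

Lemma hdotDr x y z : hdot x (y + z) = hdot x y + hdot x z.
Proof.
by rewrite -big_split; apply: eq_bigr => j _; rewrite mxE rmorphD mulrDr.
Qed.

Lemma rdotC x y : rdot x y = rdot y x.
Proof.
rewrite /rdot /hdot !raddf_sum; apply: eq_bigr => j _ /=.
by rewrite !re_scalarM !re_conj !im_conj; ring.
Qed.

Lemma rdotDr x y z : rdot x (y + z) = rdot x y + rdot x z.
Proof. by rewrite /rdot hdotDr raddfD. Qed.

Lemma rdotZr a x y : rdot x (of_real F a *: y) = a * rdot x y.
Proof.
rewrite /rdot /hdot !raddf_sum mulr_sumr; apply: eq_bigr => j _ /=.
by rewrite mxE rmorphM /= conj_of_real mulrCA re_of_realM.
Qed.

Lemma rdotNr x y : rdot x (- y) = - rdot x y.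
Proof.
rewrite -[RHS]mulN1r -rdotZr; congr (rdot _ _).
by rewrite rmorphN1 scaleN1r.
Qed.

Lemma sqr_enorm x : enorm x ^+ 2 = rdot x x.
Proof.
rewrite /enorm sqr_sqrtr; last by apply: sumr_ge0 => j _; exact: sqr_ge0.
by rewrite /rdot /hdot raddf_sum; apply: eq_bigr => j _; rewrite sqr_modulusE.
Qed.

Lemma enorm_ge0 x : 0 <= enorm x.
Proof. exact: sqrtr_ge0. Qed.

Lemma enorm1_rdot x : enorm x = 1 <-> rdot x x = 1.
Proof.
rewrite -sqr_enorm; split=> [->|/eqP]; first by rewrite expr1n.
by rewrite pexpr_eq1 ?enorm_ge0// => /eqP.
Qed.

Lemma enorm_eq0 x : (enorm x == 0) = (x == 0).
Proof.
apply/idP/eqP => [|->]; last first.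
  rewrite /enorm big1 ?sqrtr0// => j _; by rewrite mxE modulus0 expr0n.
rewrite /enorm sqrtr_eq0 => x0; apply/rowP => j; rewrite mxE.
apply/eqP; rewrite -modulus_eq0 -sqrf_eq0; apply/eqP/le_anti.
rewrite sqr_ge0 andbT (le_trans _ x0)// (bigD1 j)//= lerDl.
by rewrite sumr_ge0// => i _; exact: sqr_ge0.
Qed.

Lemma enormZ a x : enorm (a *: x) = modulus a * enorm x.
Proof.
rewrite -[modulus a](@ger0_norm R) ?modulus_ge0// -sqrtr_sqr /enorm.
rewrite -sqrtrM ?sqr_ge0//.
congr Num.sqrt; rewrite mulr_sumr; apply: eq_bigr => j _.
by rewrite mxE modulusM exprMn.
Qed.

Lemma enormN x : enorm (- x) = enorm x.
Proof. by rewrite -scaleN1r enormZ modulusN modulus1 mul1r. Qed.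

Lemma enorm_conj x : enorm (map_mx (@conj_scalar R F) x) = enorm x.
Proof.
by congr Num.sqrt; apply: eq_bigr => j _; rewrite mxE modulus_conj.
Qed.

Definition normalize x := of_real F (enorm x)^-1 *: x.

Lemma enorm_normalize x : x != 0 -> enorm (normalize x) = 1.
Proof.
rewrite -enorm_eq0 => x0.
by rewrite enormZ modulus_of_real ger0_norm ?invr_ge0 ?enorm_ge0// mulVf.
Qed.

Lemma normalizeK x : of_real F (enorm x) *: normalize x = x.
Proof.
have [->|x0] := eqVneq x 0; first by rewrite /normalize !scaler0.
by rewrite scalerA -rmorphM mulfV ?enorm_eq0// rmorph1 scale1r.
Qed.

(* Equality case of Cauchy-Schwarz: [a] must be [conj y] up to a factor. *)
Lemma pairing_extremal (a y : 'rV[K]_n) :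
  (forall z, enorm z = 1 -> modulus (pairing z a) <= modulus (pairing y a)) ->
  enorm y = 1 -> forall z, pairing z a = pairing y a * hdot z y.
Proof.
move=> amax y1; set c := pairing y a.
(* The bound comes from testing maximality on the normalized conjugate of [a]. *)
have a_le : enorm a <= modulus c.
  have [a0|a0] := eqVneq a 0.
    by move: (a0) => /eqP; rewrite -enorm_eq0 => /eqP ->; exact: modulus_ge0.
  have ca0 : map_mx (@conj_scalar R F) a != 0.
    by rewrite -enorm_eq0 enorm_conj enorm_eq0.
  apply: le_trans (amax _ (enorm_normalize ca0)).
  rewrite pairingZl modulusM modulus_of_real enorm_conj.
  have -> : pairing (map_mx (@conj_scalar R F) a) a = of_real F (enorm a ^+ 2).
    rewrite /enorm sqr_sqrtr; last by apply: sumr_ge0 => j _; exact: sqr_ge0.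
    by rewrite rmorph_sum; apply: eq_bigr => j _; rewrite mxE mulrC mul_conj.
  rewrite modulus_of_real !ger0_norm ?sqr_ge0 ?invr_ge0 ?enorm_ge0//.
  by rewrite expr2 mulKf// enorm_eq0.
have aE j : a 0 j = c * conj_scalar (y 0 j).
  apply/eqP; rewrite -subr_eq0 -modulus_eq0 -sqrf_eq0.
  apply/eqP/le_anti; rewrite sqr_ge0 andbT.
  (* Since [y] is a unit vector, this sum expands to [|a|^2 - |c|^2]. *)
  have : \sum_i modulus (a 0 i - c * conj_scalar (y 0 i)) ^+ 2 <= 0.
    have termE i : modulus (a 0 i - c * conj_scalar (y 0 i)) ^+ 2 =
        modulus (a 0 i) ^+ 2 + modulus c ^+ 2 * modulus (y 0 i) ^+ 2 -
        2 * re_scalar (conj_scalar c * (y 0 i * a 0 i)).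
      rewrite sqr_modulusB modulusM modulus_conj exprMn rmorphM /= conj_scalarK.
      by congr (_ - _ * re_scalar _); ring.
    under eq_bigr do rewrite termE.
    rewrite big_split/= big_split/= sumrN -!mulr_sumr -raddf_sum -mulr_sumr /=.
    rewrite -/(pairing y a) -/c [conj_scalar c * c]mulrC mul_conj re_of_real.
    have sE (v : 'rV[K]_n) : \sum_i modulus (v 0 i : K) ^+ 2 = enorm v ^+ 2.
      by rewrite sqr_sqrtr//; apply: sumr_ge0 => i _; exact: sqr_ge0.
    rewrite !sE y1.
    have : enorm a ^+ 2 <= modulus c ^+ 2.
      by rewrite ler_sqr ?nnegrE ?enorm_ge0 ?modulus_ge0.
    by lra.
  apply: le_trans; rewrite (bigD1 j)//= lerDl.
  by rewrite sumr_ge0// => i _; exact: sqr_ge0.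
move=> z; rewrite mulr_sumr; apply: eq_bigr => j _.
by rewrite aE mulrCA.
Qed.

End InnerProduct.

(** * Tensors as multilinear forms and their top eigenvalue *)

Section TensorForm.
Variables (R : realType) (F : scalar_kind) (n k : nat).
Local Notation K := (scalars R F).
Implicit Types (T : tensor R F n k) (u v : 'I_k -> 'rV[K]_n).

Definition subst_slot u l (w : 'rV[K]_n) : 'I_k -> 'rV[K]_n :=
  fun m => if m == l then w else u m.

Lemma subst_slot_same u l : subst_slot u l (u l) = u.
Proof. by apply/funext => m; rewrite /subst_slot; case: eqVneq => // ->. Qed.

Lemma unit_subst_slot u l w :
  unit_vectors u -> enorm w = 1 -> unit_vectors (subst_slot u l w).
Proof. by move=> uu w1 m; rewrite /subst_slot; case: ifP. Qed.

Definition slot_coefficients T u l : 'rV[K]_n :=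
  \row_j tensor_form T (subst_slot u l (delta_mx 0 j)).

(** Linearity in one slot, in the shape that [pairing_extremal] requires. *)
Lemma tensor_form_subst T u l w :
  tensor_form T (subst_slot u l w) = pairing w (slot_coefficients T u l).
Proof.
have slotE (v : 'rV[K]_n) (i : {ffun 'I_k -> 'I_n}) :
    \prod_m subst_slot u l v m 0 (i m) =
    v 0 (i l) * \prod_(m | m != l) u m 0 (i m).
  rewrite (bigD1 l)//= {1}/subst_slot eqxx; congr (_ * _).
  by apply: eq_bigr => m /negbTE ml; rewrite /subst_slot ml.
rewrite /tensor_form /pairing.
under [RHS]eq_bigr do rewrite mxE mulr_sumr.
rewrite exchange_big; apply: eq_bigr => i _ /=.
rewrite slotE [RHS](bigD1 (i l))//= [X in _ = _ + X]big1 => [|j ji].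
  by rewrite addr0 slotE mxE !eqxx mul1r mulrCA.
by rewrite slotE mxE eqxx eq_sym (negbTE ji)/= !(mul0r, mulr0).
Qed.

Lemma tensor_form_scale T (a : 'I_k -> K) u :
  tensor_form T (fun l => a l *: u l) = (\prod_l a l) * tensor_form T u.
Proof.
rewrite mulr_sumr; apply: eq_bigr => i _; rewrite mulrCA; congr (_ * _).
by rewrite -big_split; apply: eq_bigr => l _; rewrite mxE.
Qed.

Lemma tensor_form_perm T u (s : 'S_k) :
  symmetric_tensor T -> tensor_form T (fun l => u (s l)) = tensor_form T u.
Proof.
move=> Tsym; rewrite /tensor_form.
rewrite (reindex (fun i : {ffun 'I_k -> 'I_n} => [ffun l => i (s l)])) /=.
  apply: eq_bigr => i _; rewrite Tsym; congr (_ * _).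
  rewrite [RHS](reindex_inj (@perm_inj _ s)) /=.
  by apply: eq_bigr => l _; rewrite ffunE.
exists (fun i : {ffun 'I_k -> 'I_n} => [ffun l => i (s^-1 l)%g]) => i _.
  by apply/ffunP => l; rewrite !ffunE permKV.
by apply/ffunP => l; rewrite !ffunE permK.
Qed.

Lemma unit_tuple_closed :
  closed (fun p : 'rV[R]_#|{: 'I_k * 'I_n * bool}| =>
            unit_vectors (tuple_of_coords F p)).
Proof.
(* Squared norms replace norms, being polynomial in the coordinates. *)
rewrite (_ : (fun p => _) = \bigcap_(l in setT)
  ((fun p : 'rV[R]_#|{: 'I_k * 'I_n * bool}| =>
     \sum_j modulus (tuple_of_coords F p l 0 j) ^+ 2) @^-1` [set 1]))%classic.
  apply: closed_bigI => l _; apply: preimage_closed; last exact: closed_eq.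
  move=> p _; apply: continuous_sum => j.
  by apply: continuous_sqr_modulus; exact: tuple_of_coords_continuous.
apply/funext => p; apply/propext; split=> [up l _|up l].
  rewrite /= -(sqr_sqrtr (_ : 0 <= \sum_j _)) -?/(enorm _) ?(up l) ?expr1n//.
  by apply: sumr_ge0 => j _; exact: sqr_ge0.
by have /= := up l I; rewrite /enorm => ->; rewrite sqrtr1.
Qed.

Lemma tensor_form_continuous T :
  continuous (fun p : 'rV[R]_#|{: 'I_k * 'I_n * bool}| =>
    modulus (tensor_form T (tuple_of_coords F p)) ^+ 2).
Proof.
apply: continuous_sqr_modulus; apply: scalar_continuous_sum => i.
apply: scalar_continuousM; first exact: scalar_continuous_cst.
by apply: scalar_continuous_prod => l; exact: tuple_of_coords_continuous.
Qed.

Lemma lambda_max_attained T :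
  (exists u, unit_vectors u) ->
  (exists2 v, unit_vectors v & modulus (tensor_form T v) = lambda_max T) /\
  (forall u, unit_vectors u -> modulus (tensor_form T u) <= lambda_max T).
Proof.
move=> [u0 u0u].
have [||v vu vmax] := @argmax_unit_tuple R F n k (@unit_vectors R F n k)
  (fun u => modulus (tensor_form T u) ^+ 2) _ (fun _ => id) unit_tuple_closed.
- by exists u0.
- exact: tensor_form_continuous.
have vmax' u : unit_vectors u ->
    modulus (tensor_form T u) <= modulus (tensor_form T v).
  by move=> /vmax; rewrite ler_sqr ?nnegrE ?modulus_ge0.
suff -> : lambda_max T = modulus (tensor_form T v) by split=> //; exists v.
apply/le_anti/andP; split.
  apply: ge_sup; first by exists (modulus (tensor_form T u0)), u0.
  by move=> _ [u uu <-]; exact: vmax'.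
apply: ub_le_sup; last by exists v.
by exists (modulus (tensor_form T v)) => _ [u uu <-]; exact: vmax'.
Qed.

(** Without unit tuples the supremum is taken over the empty set and equals 0. This settles [n = 0]
    without a case distinction. *)
Lemma unit_vectors_exist T :
  0 < lambda_max T -> exists u : 'I_k -> 'rV[K]_n, unit_vectors u.
Proof.
move=> T0; apply: contrapT => no_unit; move: T0.
rewrite /lambda_max (_ : [set _ | _ in _]%classic = set0).
  by rewrite sup0 ltxx.
by apply/seteqP; split=> // c [u uu _]; apply: no_unit; exists u.
Qed.

End TensorForm.

(** * Banach's theorem for symmetric tensors *)

Section SymmetricMaximizer.
Variables (R : realType) (F : scalar_kind) (n k : nat).
Local Notation K := (scalars R F).
Implicit Types (T : tensor R F n k) (u v : 'I_k -> 'rV[K]_n).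

Definition top_tuple T u : Prop :=
  unit_vectors u /\
  forall v, unit_vectors v -> modulus (tensor_form T v) <= modulus (tensor_form T u).

(** With the other slots frozen, the linear form in slot [m] has maximal modulus at the unit vector
    [u m], so [pairing_extremal] determines it. *)
Lemma top_tuple_subst T u m z : top_tuple T u ->
  tensor_form T (subst_slot u m z) = tensor_form T u * hdot z (u m).
Proof.
move=> [uu umax].
have cE : tensor_form T u = pairing (u m) (slot_coefficients T u m).
  by rewrite -tensor_form_subst subst_slot_same.
rewrite tensor_form_subst (pairing_extremal _ (uu m)) -?cE// => v v1.
by rewrite -tensor_form_subst; apply: umax; exact: unit_subst_slot.
Qed.

Lemma subst_slotC u l m a b : l != m ->
  subst_slot (subst_slot u l a) m b = subst_slot (subst_slot u m b) l a.
Proof.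
move=> lm; apply/funext => p; rewrite /subst_slot.
by case: (eqVneq p m) => [->|//]; rewrite eq_sym (negbTE lm).
Qed.

Lemma top_pair_sum T u l m : symmetric_tensor T -> top_tuple T u -> l != m ->
  let w := u l + u m in
  tensor_form T (subst_slot (subst_slot u l w) m w) =
  tensor_form T u * of_real F (enorm w ^+ 2).
Proof.
move=> Tsym utop lm w.
have addl z : tensor_form T (subst_slot (subst_slot u l w) m z) =
    tensor_form T (subst_slot (subst_slot u l (u l)) m z) +
    tensor_form T (subst_slot (subst_slot u l (u m)) m z).
  by rewrite !(subst_slotC _ _ _ lm) !tensor_form_subst -pairingDl.
(* Exchanging the two vectors preserves the value by symmetry, so [u'] is again a top tuple, now
   with [u l] in slot [m]. *)
pose u' p := u (tperm l m p).
have Tu' : tensor_form T u' = tensor_form T u by exact: tensor_form_perm.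
have u'top : top_tuple T u' by split=> [p|v /utop.2]; [exact: utop.1|rewrite Tu'].
have u'E z : subst_slot (subst_slot u l (u m)) m z = subst_slot u' m z.
  apply/funext => p; rewrite /subst_slot /u'; case: (eqVneq p m) => // pm.
  by case: (eqVneq p l) => [->|pl]; rewrite ?tpermL// tpermD// eq_sym.
rewrite addl subst_slot_same u'E !top_tuple_subst// Tu' -mulrDr -hdotDr.
rewrite /u' tpermR addrC -/w; congr (_ * _).
rewrite /enorm sqr_sqrtr; last by apply: sumr_ge0 => j _; exact: sqr_ge0.
by rewrite rmorph_sum; apply: eq_bigr => j _; rewrite mul_conj.
Qed.

(** Normalizing in two slots contributes [|w|^-2], which cancels the factor [|w|^2] of
    [top_pair_sum]. *)
Lemma top_tuple_merge T u l m : symmetric_tensor T -> top_tuple T u -> l != m ->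
  let w := u l + u m in w != 0 ->
  let v := subst_slot (subst_slot u l (normalize w)) m (normalize w) in
  unit_vectors v /\ modulus (tensor_form T v) = modulus (tensor_form T u).
Proof.
move=> Tsym utop lm w w0 v; have w1 := enorm_normalize w0.
split.
  by do 2 (apply: unit_subst_slot => //); exact: utop.1.
rewrite /v /normalize tensor_form_subst pairingZl -tensor_form_subst subst_slotC//.
rewrite tensor_form_subst pairingZl -tensor_form_subst -subst_slotC//.
rewrite top_pair_sum// !modulusM !modulus_of_real -/w.
rewrite !ger0_norm ?sqr_ge0 ?invr_ge0 ?enorm_ge0//.
have : enorm w != 0 by rewrite enorm_eq0.
by move=> ?; field.
Qed.

Lemma sum_pairD (l m : 'I_k) (f : 'I_k -> R) : l != m ->
  \sum_p f p = f l + f m + \sum_(p | (p != l) && (p != m)) f p.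
Proof. by move=> lm; rewrite (bigD1 l)//= (bigD1 m)//= ?addrA// eq_sym. Qed.

(* Strictly increases when two vectors [x != +-y] of a top tuple are both
   replaced by the better of their bisectors [x + y] and [x - y], normalized. *)
Definition alignment u : R := \sum_p \sum_q rdot (u p) (u q) ^+ 2.

(** Isolates what changes when slots [l] and [m] are modified. The constant 2 is the sum of the two
    diagonal terms; the other factors 2 count ordered pairs. *)
Lemma alignment_pair u l m : unit_vectors u -> l != m ->
  alignment u =
  \sum_(p | (p != l) && (p != m)) \sum_(q | (q != l) && (q != m))
     rdot (u p) (u q) ^+ 2 +
  2 * \sum_(p | (p != l) && (p != m)) rdot (u p) (u l) ^+ 2 +
  2 * \sum_(p | (p != l) && (p != m)) rdot (u p) (u m) ^+ 2 +
  2 + 2 * rdot (u l) (u m) ^+ 2.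
Proof.
move=> uu lm; have u1 p : rdot (u p) (u p) = 1 by apply/enorm1_rdot.
have rowE p : \sum_(q | (q != l) && (q != m)) rdot (u p) (u q) ^+ 2 =
    \sum_(q | (q != l) && (q != m)) rdot (u q) (u p) ^+ 2.
  by apply: eq_bigr => q _; rewrite rdotC.
rewrite /alignment (sum_pairD _ lm) 2!(sum_pairD (fun q => _ ^+ 2) lm).
under [X in _ + _ + X = _]eq_bigr do rewrite (sum_pairD _ lm).
rewrite !big_split/= !rowE !u1 (rdotC (u m)); ring.
Qed.

(** Let [t = rdot (u l) (u m)], and let [X], [Y], [N] be the sums of squared products of the other
    vectors with [u l], [u m] and the normalized bisector. Comparing alignments before and after the
    merge gives [4 N + 4 <= 2 X + 2 Y + 2 + 2 t^2]. Multiplying by [|w|^2 = 2 + 2 t] removes the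
    normalization and covers [w = 0] too. *)
Lemma alignment_merge T u l m :
  symmetric_tensor T -> top_tuple T u -> l != m ->
  (forall v, unit_vectors v ->
     modulus (tensor_form T v) = modulus (tensor_form T u) ->
     alignment v <= alignment u) ->
  4 * \sum_(p | (p != l) && (p != m)) rdot (u p) (u l + u m) ^+ 2 <=
  (2 + 2 * rdot (u l) (u m)) *
  (2 * \sum_(p | (p != l) && (p != m)) rdot (u p) (u l) ^+ 2 +
   2 * \sum_(p | (p != l) && (p != m)) rdot (u p) (u m) ^+ 2 -
   2 + 2 * rdot (u l) (u m) ^+ 2).
Proof.
move=> Tsym utop lm umax; set w := u l + u m.
have u1 p : rdot (u p) (u p) = 1 by apply/enorm1_rdot; exact: utop.1.
have wE : 2 + 2 * rdot (u l) (u m) = enorm w ^+ 2.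
  rewrite sqr_enorm /w rdotDr !(rdotC (_ + _)) !rdotDr !u1 (rdotC (u m)); ring.
have [w0|w0] := eqVneq w 0.
  rewrite w0 wE w0 (_ : enorm 0 = 0); last by apply/eqP; rewrite enorm_eq0.
  rewrite expr0n mul0r big1 ?mulr0// => p _.
  by rewrite -(scale0r (0 : 'rV[K]_n)) -(rmorph0 (of_real F)) rdotZr mul0r expr0n.
have [vu vT] := top_tuple_merge Tsym utop lm w0.
have := umax _ vu vT; rewrite (alignment_pair vu lm) (alignment_pair utop.1 lm).
set v := subst_slot _ _ _.
have vE p : (p != l) && (p != m) -> v p = u p.
  by move=> /andP[/negbTE pl /negbTE pm]; rewrite /v /subst_slot pl pm.
have vm : v m = normalize w by rewrite /v /subst_slot eqxx.
have vl : v l = normalize w by rewrite /v /subst_slot eqxx (negbTE lm).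
rewrite vm vl.
under eq_bigr => p hp do
  (rewrite (vE _ hp); under eq_bigr => q hq do rewrite (vE _ hq)).
under [\sum_(p | _) rdot (v p) _ ^+ 2]eq_bigr => p hp do rewrite (vE _ hp).
have -> : rdot (normalize w) (normalize w) = 1 by apply/enorm1_rdot/enorm_normalize.
set N := \sum_(p | _) rdot _ (normalize w) ^+ 2.
have -> : \sum_(p | (p != l) && (p != m)) rdot (u p) w ^+ 2 = enorm w ^+ 2 * N.
  rewrite mulr_sumr; apply: eq_bigr => p _.
  by rewrite -{1}(normalizeK w) rdotZr exprMn.
rewrite wE expr1n => h; rewrite mulrCA ler_wpM2l ?sqr_ge0//.
by move: h; lra.
Qed.

(** Flipping the sign of [u m] changes neither the modulus of the form nor the alignment, so
    [alignment_merge] applies to both bisectors. *)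
Lemma aligned_top_tuple_proportional T u :
  symmetric_tensor T -> top_tuple T u ->
  (forall v, unit_vectors v ->
     modulus (tensor_form T v) = modulus (tensor_form T u) ->
     alignment v <= alignment u) ->
  forall l m, l != m -> u l = u m \/ u l = - u m.
Proof.
move=> Tsym utop umax l m lm.
pose u' := subst_slot u m (- u m).
have u'scale : u' = (fun p => (if p == m then -1 else 1) *: u p).
  apply/funext => p; rewrite /u' /subst_slot.
  by case: eqVneq => [->|_]; rewrite ?scaleN1r ?scale1r.
have u'u : unit_vectors u'.
  by apply: unit_subst_slot; [exact: utop.1|rewrite enormN; exact: utop.1].
have Tu' : modulus (tensor_form T u') = modulus (tensor_form T u).
  rewrite u'scale tensor_form_scale modulusM modulus_prod big1 ?mul1r// => p _.
  by case: ifP; rewrite ?modulusN modulus1.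
have sqN a b : rdot a (- b) ^+ 2 = rdot a b ^+ 2 :> R by rewrite rdotNr sqrrN.
have Au' : alignment u' = alignment u.
  apply: eq_bigr => p _; apply: eq_bigr => q _.
  rewrite u'scale; case: ifP => _; case: ifP => _;
    by rewrite ?scaleN1r ?scale1r ?sqN// rdotC sqN rdotC.
have u'top : top_tuple T u' by split=> // v /utop.2; rewrite Tu'.
have u'max v : unit_vectors v ->
     modulus (tensor_form T v) = modulus (tensor_form T u') ->
     alignment v <= alignment u'.
  by rewrite Au' Tu'; exact: umax.
have h := alignment_merge Tsym utop lm umax.
have h' := alignment_merge Tsym u'top lm u'max.
have u'm : u' m = - u m by rewrite /u' /subst_slot eqxx.
have u'p p : p != m -> u' p = u p by rewrite /u' /subst_slot => /negbTE ->.
move: h'; rewrite u'm (u'p l)//.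
under eq_bigr => p /andP[_ pm] do rewrite (u'p _ pm).
under [\sum_(p | _) rdot (u' p) (u l) ^+ 2]eq_bigr => p /andP[_ pm]
  do rewrite (u'p _ pm).
under [\sum_(p | _) rdot (u' p) (- _) ^+ 2]eq_bigr => p /andP[_ pm]
  do rewrite (u'p _ pm) sqN.
rewrite sqN rdotNr => h'.
set t := rdot (u l) (u m) in h h'.
set X := \sum_(p | _) rdot (u p) (u l) ^+ 2 in h h'.
set Y := \sum_(p | _) rdot (u p) (u m) ^+ 2 in h h'.
have parallelogram :
    \sum_(p | (p != l) && (p != m)) rdot (u p) (u l + u m) ^+ 2 +
    \sum_(p | (p != l) && (p != m)) rdot (u p) (u l - u m) ^+ 2 =
    2 * X + 2 * Y.
  rewrite /X /Y !mulr_sumr -!big_split/=; apply: eq_bigr => p _.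
  by rewrite !rdotDr rdotNr; ring.
(* When the two inequalities are added, the factors [2 + 2 t] and [2 - 2 t] sum to 4; by the
   parallelogram identity what remains is [t^2 >= 1]. *)
have t1 : 1 <= t ^+ 2.
  move: h h' parallelogram; set P := \sum_(p | _) _; set M := \sum_(p | _) _.
  by move=> h h' e; nra.
have u1 p : rdot (u p) (u p) = 1 by apply/enorm1_rdot; exact: utop.1.
have sE : enorm (u l + u m) ^+ 2 = 2 + 2 * t.
  rewrite sqr_enorm rdotDr !(rdotC (_ + _)) !rdotDr !u1 (rdotC (u m)) -/t; ring.
have dE : enorm (u l - u m) ^+ 2 = 2 - 2 * t.
  rewrite sqr_enorm rdotDr rdotNr !(rdotC (_ - _)) !rdotDr !rdotNr !u1.
  by rewrite (rdotC (u m)) -/t; ring.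
(* The square equals [4 - 4 t^2], so one of the two bisectors vanishes. *)
have : (enorm (u l + u m) * enorm (u l - u m)) ^+ 2 <= 0.
  by rewrite exprMn sE dE; nra.
move=> e0; have : (enorm (u l + u m) * enorm (u l - u m)) ^+ 2 == 0.
  by rewrite eq_le e0 sqr_ge0.
rewrite sqrf_eq0 mulf_eq0 !enorm_eq0 addr_eq0 subr_eq0.
by case/orP => /eqP; [right|left].
Qed.

Lemma alignment_continuous :
  continuous (fun p : 'rV[R]_#|{: 'I_k * 'I_n * bool}| =>
    alignment (tuple_of_coords F p)).
Proof.
apply: continuous_sum => l; apply: continuous_sum => m.
have rc : continuous (fun p : 'rV[R]_#|{: 'I_k * 'I_n * bool}| =>
    rdot (tuple_of_coords F p l) (tuple_of_coords F p m)).
  suff [] : scalar_continuous (fun p : 'rV[R]_#|{: 'I_k * 'I_n * bool}| =>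
      hdot (tuple_of_coords F p l) (tuple_of_coords F p m)) by [].
  apply: scalar_continuous_sum => j; apply: scalar_continuousM.
    exact: tuple_of_coords_continuous.
  by apply: scalar_continuous_conj; exact: tuple_of_coords_continuous.
move=> p; under eq_fun do rewrite expr2.
exact: (cvgM (rc p) (rc p)).
Qed.

Lemma symmetric_lambda_max_attained T :
  symmetric_tensor T -> (0 < k)%N ->
  (exists u : 'I_k -> 'rV[K]_n, unit_vectors u) ->
  exists2 v : 'rV[K]_n, enorm v = 1 &
    modulus (tensor_form T (fun=> v)) = lambda_max T.
Proof.
move=> Tsym k0 ex; have [[v0 v0u v0T] maxT] := lambda_max_attained T ex.
(* Squares make the condition on the form continuous in the coordinates, hence [A] closed. *)
pose A u := unit_vectors u /\ modulus (tensor_form T u) ^+ 2 = lambda_max T ^+ 2.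
have [||||u [uu uT] umax] := @argmax_unit_tuple R F n k A alignment.
- by exists v0; split=> //; rewrite v0T.
- by move=> u [].
- rewrite (_ : (fun p => _) =
    ((fun p : 'rV[R]_#|{: 'I_k * 'I_n * bool}| =>
        unit_vectors (tuple_of_coords F p)) `&`
    ((fun p => modulus (tensor_form T (tuple_of_coords F p)) ^+ 2) @^-1`
      [set lambda_max T ^+ 2]))%classic)//.
  apply: closedI; first exact: unit_tuple_closed.
  apply: preimage_closed; last exact: closed_eq.
  by move=> p _; exact: tensor_form_continuous.
- exact: alignment_continuous.
have L0 : 0 <= lambda_max T by rewrite -v0T modulus_ge0.
have uT' : modulus (tensor_form T u) = lambda_max T.
  by apply/eqP; rewrite -(@eqrXn2 R 2) ?modulus_ge0// uT.
have utop : top_tuple T u by split=> // v; rewrite uT'; exact: maxT.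
have prop := aligned_top_tuple_proportional Tsym utop.
pose l0 := Ordinal k0.
exists (u l0); first exact: uu.
have uE : u = (fun p => (if u p == u l0 then 1 else -1) *: u l0).
  apply/funext => p; case: eqVneq => [->|up]; first by rewrite scale1r.
  have [pl|pl] := eqVneq p l0; first by rewrite pl eqxx in up.
  case: (prop _ _ _ pl) => [v vu vT|upl|->].
  - by apply: umax; split=> //; rewrite vT uT'.
  - by rewrite upl eqxx in up.
  - by rewrite scaleN1r.
(* The signs factor out of the form as a product of modulus 1. *)
rewrite -uT' [in RHS]uE tensor_form_scale modulusM modulus_prod big1 ?mul1r// => p _.
by case: ifP; rewrite ?modulusN modulus1.
Qed.

End SymmetricMaximizer.

(** * Greedy decomposition *)

Section Greedy.
Variables (R : realType) (F : scalar_kind) (n k : nat).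
Local Notation K := (scalars R F).
Implicit Types (T Q : tensor R F n k) (u v : 'I_k -> 'rV[K]_n) (lam theta : R).

Lemma sqr_frobenius T :
  frobenius_norm T ^+ 2 = \sum_(i : {ffun 'I_k -> 'I_n}) modulus (T i : K) ^+ 2.
Proof. by rewrite sqr_sqrtr// sumr_ge0// => i _; exact: sqr_ge0. Qed.

(** The sum over multi-indices factors into the product over slots of the squared norms. *)
Lemma sum_sqr_rank_one u : unit_vectors u ->
  \sum_(i : {ffun 'I_k -> 'I_n}) modulus (rank_one u i : K) ^+ 2 = 1.
Proof.
move=> uu; under eq_bigr do rewrite ffunE modulus_prod -prodrXl.
rewrite -(bigA_distr_bigA (fun l j => modulus (u l 0 j) ^+ 2)) big1// => l _.
by rewrite -(expr1n _ 2) -(uu l) sqr_sqrtr// sumr_ge0// => j _; exact: sqr_ge0.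
Qed.

(** The cross term is [2 lam] times the real part of the form at the conjugates of [u], which is
    [lam] itself; the change is thus [lam^2 - 2 lam^2]. *)
Lemma sqr_frobenius_sub_eigenpair T lam u :
  top_eigenpair T (of_real F lam) u ->
  frobenius_norm (T - of_real F lam *: rank_one u) ^+ 2 =
  frobenius_norm T ^+ 2 - lambda_max T ^+ 2.
Proof.
move=> [uu lamE lamT]; rewrite !sqr_frobenius -lamT modulus_of_real.
rewrite real_normK ?num_real//.
have termE (i : {ffun 'I_k -> 'I_n}) :
    modulus ((T - of_real F lam *: rank_one u) i : K) ^+ 2 =
    modulus (T i : K) ^+ 2 + lam ^+ 2 * modulus (rank_one u i : K) ^+ 2 -
    2 * lam * re_scalar ((T i : K) *
      \prod_l map_mx (@conj_scalar R F) (u l) 0 (i l)).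
  rewrite !ffunE sqr_modulusB modulusM modulus_of_real exprMn.
  rewrite real_normK ?num_real// rmorphM /= conj_of_real rmorph_prod.
  rewrite [T i * _]mulrCA.
  rewrite re_of_realM mulrA; congr (_ - _ * re_scalar (_ * _)).
  by apply: eq_bigr => l _; rewrite mxE.
under eq_bigr do rewrite termE.
rewrite big_split/= big_split/= sumrN -!mulr_sumr -raddf_sum /=.
rewrite -/(tensor_form T (fun l => map_mx (@conj_scalar R F) (u l))) -lamE.
by rewrite re_of_real sum_sqr_rank_one//; ring.
Qed.

(** Abstracts one peeling step so that the general and the symmetric case share the induction: [D]
    holds the data of a rank-one term, [good] what is recorded about it, [inv] what residuals
    preserve. The number [m] bounds the remaining steps. The case [N = 0] is kept apart because the
    strict bound then fails for a zero [Q]. *)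
Lemma greedy_expansion (D : Type) (term : D -> tensor R F n k)
    (good : tensor R F n k -> D -> Prop) (inv : tensor R F n k -> Prop) theta :
  (forall Q, inv Q -> theta < lambda_max Q -> exists d,
     [/\ good Q d, inv (Q - term d) &
         frobenius_norm (Q - term d) ^+ 2 < frobenius_norm Q ^+ 2 - theta ^+ 2]) ->
  forall m Q, inv Q -> frobenius_norm Q ^+ 2 <= m%:R * theta ^+ 2 ->
  exists (N : nat) (d : 'I_N -> D),
    [/\ N = 0 \/ N%:R * theta ^+ 2 < frobenius_norm Q ^+ 2,
        lambda_max (Q - \sum_j term (d j)) <= theta &
        forall j : 'I_N, good (Q - \sum_(i < N | (i < j)%N) term (d i)) (d j)].
Proof.
move=> step; elim=> [|m IH] Q Qinv Qm;
    have [small|large] := leP (lambda_max Q) theta.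
(* [D] may be empty, so the family over ['I_0] comes from absurdity. *)
- exists 0, (fun j : 'I_0 => False_rect D (notF (ltn_ord j))).
  by split; [left|rewrite big_ord0 subr0|case].
(* With [m = 0] the squared norm of [Q] is at most 0, so no further decrease is possible. *)
- have [d [_ _]] := step Q Qinv large.
  have := sqr_ge0 (frobenius_norm (Q - term d)); have := sqr_ge0 theta.
  by move: Qm; rewrite mul0r; lra.
- exists 0, (fun j : 'I_0 => False_rect D (notF (ltn_ord j))).
  by split; [left|rewrite big_ord0 subr0|case].
have [d0 [gd0 invQ' lt0]] := step Q Qinv large.
have [|N [d [Nle dmax dgood]]] := IH _ invQ'.
  by move: Qm; rewrite -natr1 mulrDl mul1r; lra.
(* The first term goes in front of the family found for the residual. *)
exists N.+1, (fun j => oapp d d0 (unlift ord0 j)); split.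
- right; have := sqr_ge0 (frobenius_norm (Q - term d0)).
  rewrite -natr1 mulrDl mul1r.
  by case: Nle => [->|]; rewrite ?mul0r; lra.
- rewrite big_ord_recl unlift_none /=; under eq_bigr do rewrite liftK /=.
  by rewrite opprD addrA.
move=> j; rewrite big_mkcond big_ord_recl unlift_none /=.
under eq_bigr do rewrite liftK /=.
(* For a lifted index [j'] the first term is always among those subtracted; for index 0 nothing
   is. *)
case: (unliftP ord0 j) => [j'|] -> /=; last by rewrite add0r big1// subr0.
rewrite opprD addrA (_ : \sum_(i < N) _ = \sum_(i < N | (i < j')%N) term (d i)).
  exact: dgood.
by rewrite [RHS]big_mkcond; apply: eq_bigr => i _.
Qed.

Lemma conj_vectorK (x : 'rV[K]_n) :
  map_mx (@conj_scalar R F) (map_mx (@conj_scalar R F) x) = x.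
Proof. by apply/rowP => j; rewrite !mxE conj_scalarK. Qed.

Lemma top_eigenpair_exists T : (0 < k)%N -> 0 < lambda_max T ->
  exists u, top_eigenpair T (of_real F (lambda_max T)) u.
Proof.
move=> k0 T0; have [[v vu vT] _] := lambda_max_attained T (unit_vectors_exist T0).
have Tv0 : 0 < modulus (tensor_form T v) by rewrite vT.
have [w [w1]] := exists_root_phase (ltn0Sn 0) (fun=> isT) Tv0.
rewrite expr1 vT => wT.
(* The first slot absorbs the whole phase. The tuple below is conjugated because [top_eigenpair]
   evaluates the form at conjugates. *)
pose a (l : 'I_k) : K := if l == Ordinal k0 then w else 1.
exists (fun l => map_mx (@conj_scalar R F) (a l *: v l)); split.
- by move=> l; rewrite enorm_conj enormZ vu mulr1 /a; case: ifP; rewrite ?modulus1.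
- under [fun l => map_mx _ _]eq_fun do rewrite conj_vectorK.
  rewrite tensor_form_scale (bigD1 (Ordinal k0))//= big1 => [|l /negbTE l0].
    by rewrite mulr1 /a eqxx wT.
  by rewrite /a l0.
by rewrite modulus_of_real ger0_norm// ltW.
Qed.

(* For [F = RealScalars] and [k] even, [tensor_form T (fun=> u)] is even in [u],
   so its sign cannot be adjusted. *)
Lemma symmetric_top_eigenpair_exists T :
  symmetric_tensor T -> (0 < k)%N -> 0 < lambda_max T ->
  exists (lam : R) (u : 'rV[K]_n), top_eigenpair T (of_real F lam) (fun=> u) /\
    ((F = RealScalars -> odd k) -> lam = lambda_max T).
Proof.
move=> Tsym k0 T0.
have [v v1 vT] := symmetric_lambda_max_attained Tsym k0 (unit_vectors_exist T0).
have Tv0 : 0 < modulus (tensor_form T (fun=> v)) by rewrite vT.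
have [signed|] := pselect (F = RealScalars -> odd k).
  have [w [w1]] := exists_root_phase k0 signed Tv0; rewrite vT => wT.
  exists (lambda_max T), (map_mx (@conj_scalar R F) (w *: v)); split=> //; split.
  - by move=> l; rewrite enorm_conj enormZ v1 mulr1.
  - rewrite conj_vectorK (tensor_form_scale T (fun=> w)) prodr_const card_ord.
    by rewrite wT.
  - by rewrite modulus_of_real ger0_norm// ltW.
move=> unsigned; have FR : F = RealScalars.
  by apply: contrapT => nR; apply: unsigned => /nR.
(* Only real scalars remain, so the value of the form is itself a real number, of either sign, and
   can serve as [lam]. *)
have im0 (z : K) : of_real F (re_scalar z) = z.
  rewrite [RHS]scalarE /im_scalar; move: z; rewrite FR => z.
  by rewrite rmorph0 mulr0 addr0.
exists (re_scalar (tensor_form T (fun=> v))), (map_mx (@conj_scalar R F) v).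
split=> //; rewrite im0; split=> // [l|].
  by rewrite enorm_conj.
by rewrite conj_vectorK.
Qed.

Lemma symmetric_sub_rank_one T (a : K) (x : 'rV[K]_n) :
  symmetric_tensor T ->
  symmetric_tensor (T - a *: rank_one (fun _ : 'I_k => x)).
Proof.
move=> Tsym s i; rewrite !ffunE Tsym; congr (_ - a * _).
rewrite [RHS](reindex_inj (@perm_inj _ s)) /=.
by apply: eq_bigr => l _; rewrite ffunE.
Qed.

Lemma greedy_length N (eps f : R) : 0 < eps ->
  N = 0 \/ N%:R * (eps * f) ^+ 2 < f ^+ 2 -> N%:R <= 1 / eps ^+ 2.
Proof.
move=> e0 [->|lt]; first by rewrite divr_ge0// sqr_ge0.
(* A zero [f] would turn the strict inequality into [0 < 0], so [f^2] may be cancelled. *)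
have f0 : 0 < f ^+ 2.
  rewrite lt_neqAle sqr_ge0 andbT; apply: contraTneq lt => f0.
  by rewrite exprMn -f0 !mulr0 ltxx.
rewrite ler_pdivlMr ?exprn_gt0//.
by move: lt; rewrite exprMn mulrA -{2}(mul1r (f ^+ 2)) ltr_pM2r// => /ltW.
Qed.

(** Provides some finite number of steps to start the induction; the sharp count is recovered
    afterwards by [greedy_length]. *)
Lemma greedy_steps_bound (eps f : R) : 0 < eps ->
  exists m : nat, f ^+ 2 <= m%:R * (eps * f) ^+ 2.
Proof.
move=> e0; have [m hm] : exists m : nat, (eps ^+ 2)^-1 <= m%:R.
  exists (Num.bound (eps ^+ 2)^-1); apply: ltW.
  by rewrite archi_boundP// invr_ge0 sqr_ge0.
exists m; rewrite exprMn mulrA ler_peMl ?sqr_ge0//.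
by rewrite -ler_pdivrMr ?exprn_gt0// div1r.
Qed.

End Greedy.

Theorem theorem5 (R : realType) (F : scalar_kind) (n k : nat)
    (hk : (2 <= k)%N) (eps : R) (heps : 0 < eps) (tau : tensor R F n k) :
  (exists (K : nat) (lam : 'I_K -> R)
          (u : 'I_K -> 'I_k -> 'rV[scalars R F]_n) (Q : tensor R F n k),
      K%:R <= 1 / eps ^+ 2
   /\ tau = \sum_(j < K) of_real F (lam j) *: rank_one (u j) + Q
   /\ lambda_max Q <= eps * frobenius_norm tau
   /\ (forall j, unit_vectors (u j))
   /\ (forall j, eps * frobenius_norm tau < lam j)
   /\ (forall j : 'I_K,
         top_eigenpair
           (tau - \sum_(i < K | (i < j)%N) of_real F (lam i) *: rank_one (u i))
           (of_real F (lam j)) (u j)))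
  /\
  (symmetric_tensor tau ->
   exists (K : nat) (lam : 'I_K -> R)
          (u : 'I_K -> 'rV[scalars R F]_n) (Q : tensor R F n k),
      K%:R <= 1 / eps ^+ 2
   /\ tau = \sum_(j < K) of_real F (lam j) *: rank_one (fun _ : 'I_k => u j) + Q
   /\ lambda_max Q <= eps * frobenius_norm tau
   /\ (forall j, enorm (u j) = 1)
   /\ (forall j, if F is RealScalars
                 then if odd k then eps * frobenius_norm tau < lam j
                      else eps * frobenius_norm tau < `|lam j|
                 else eps * frobenius_norm tau < lam j)
   /\ (forall j : 'I_K,
         top_eigenpair
           (tau - \sum_(i < K | (i < j)%N)
                    of_real F (lam i) *: rank_one (fun _ : 'I_k => u i))
           (of_real F (lam j)) (fun _ : 'I_k => u j))).
Proof.
have k0 : (0 < k)%N by exact: ltnW.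
pose theta := eps * frobenius_norm tau.
have theta0 : 0 <= theta by rewrite mulr_ge0 ?sqrtr_ge0// ltW.
have [m hm] := greedy_steps_bound (frobenius_norm tau) heps.
have decrease (T : tensor R F n k) lam u : theta < lambda_max T ->
    top_eigenpair T (of_real F lam) u ->
    frobenius_norm (T - of_real F lam *: rank_one u) ^+ 2 <
    frobenius_norm T ^+ 2 - theta ^+ 2.
  move=> lt eig; rewrite sqr_frobenius_sub_eigenpair// ltrD2l ltrN2.
  by rewrite ltr_pXn2r ?nnegrE// ltW// (le_lt_trans theta0).
split=> [|tausym].
  pose term (d : R * ('I_k -> 'rV[scalars R F]_n)) : tensor R F n k :=
    of_real F d.1 *: rank_one d.2.
  pose good (T : tensor R F n k) (d : R * ('I_k -> 'rV[scalars R F]_n)) :=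
    theta < d.1 /\ top_eigenpair T (of_real F d.1) d.2.
  have step T : True -> theta < lambda_max T -> exists d,
      [/\ good T d, True & frobenius_norm (T - term d) ^+ 2 <
                           frobenius_norm T ^+ 2 - theta ^+ 2].
    move=> _ lt; have [u eig] := top_eigenpair_exists k0 (le_lt_trans theta0 lt).
    by exists (lambda_max T, u); split=> //; exact: decrease.
  have [N [d [Nle dmax dgood]]] := greedy_expansion step I hm.
  exists N, (fun j => (d j).1), (fun j => (d j).2), (tau - \sum_j term (d j)).
  split; first exact: greedy_length Nle.
  split; first by rewrite addrC subrK.
  split=> //; split=> [j|]; first by have [_ []] := dgood j.
  by split=> j; have [] := dgood j.
pose term (d : R * 'rV[scalars R F]_n) : tensor R F n k :=
  of_real F d.1 *: rank_one (fun=> d.2).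
pose sign_condition lam := if F is RealScalars
  then if odd k then theta < lam else theta < `|lam| else theta < lam.
pose good (T : tensor R F n k) (d : R * 'rV[scalars R F]_n) :=
  sign_condition d.1 /\ top_eigenpair T (of_real F d.1) (fun _ : 'I_k => d.2).
have step T : symmetric_tensor T -> theta < lambda_max T -> exists d,
    [/\ good T d, symmetric_tensor (T - term d) &
      frobenius_norm (T - term d) ^+ 2 < frobenius_norm T ^+ 2 - theta ^+ 2].
  move=> Tsym lt.
  have [lam [u [eig pos]]] :=
    symmetric_top_eigenpair_exists Tsym k0 (le_lt_trans theta0 lt).
  exists (lam, u); split; last 2 first.
  - exact: symmetric_sub_rank_one.
  - exact: decrease.
  split=> //; have [_ _] := eig; rewrite modulus_of_real => lamT.
  rewrite /sign_condition /=; move: pos lt lamT; move: (lambda_max T) => L.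
  case: (F) => [pos|->//] lt lamT.
  (* Over the reals with [k] even, only [|lam|] is known to be the top eigenvalue. *)
  by case: ifP => [ok|_]; [rewrite pos|rewrite lamT].
have [N [d [Nle dmax dgood]]] := greedy_expansion step tausym hm.
exists N, (fun j => (d j).1), (fun j => (d j).2), (tau - \sum_j term (d j)).
split; first exact: greedy_length Nle.
split; first by rewrite addrC subrK.
(* The unit norm is read off at slot 0, which exists since [k > 0]. *)
split=> //; split=> [j|]; first by have [_ [/(_ (Ordinal k0))]] := dgood j.
by split=> j; have [] := dgood j.
Qed.
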